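(* For binary strings $s,t\in\{0,1\}^n$, let $\mathrm{LCS}(s,t)$ denote the length of a longest common subsequence of $s$ and $t$. Let $s$ and $t$ be drawn independently and uniformly at random from $\{0,1\}^n$. Then \[ \mathbb{E}\big[\mathrm{LCS}(s,t)\big] \le 0.867\,n + o(n) \] as $n\to\infty$.
   Context: A string $u=u_1\cdots u_m$ is a subsequence of $t=t_1\cdots t_n$ if there are indices $i_1<\dots<i_m$ with $u_j=t_{i_j}$ for all $j$. A longest common subsequence of $s$ and $t$ is a longest string that is a subsequence of both. *)

(* Defs.v *)
From HB Require Import structures.
From mathcomp Require Import all_boot all_order all_algebra.
From mathcomp Require Import all_classical all_reals all_analysis.
Import Order.TTheory GRing.Theory Num.Theory.
Import numFieldNormedType.Exports.

Set Implicit Arguments.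
Unset Strict Implicit.
Unset Printing Implicit Defensive.

Local Open Scope ring_scope.

Definition is_common_subseq (T : eqType) (s t u : seq T) : bool :=
  subseq u s && subseq u t.

(* A common subsequence of s and t has length at most size s, so the bound
   m <= size s in the range of the maximum loses nothing. *)
Definition LCS (T : finType) (s t : seq T) : nat :=
  \max_(m < (size s).+1 | [exists u : m.-tuple T, is_common_subseq s t u]) m.

Definition uniform_pmf (R : realType) (T : finType) (x : T) : R := #|T|%:R^-1.

(* By independence the joint mass of (s, t) is the product of the masses. *)
Definition expected_LCS (R : realType) (n : nat) : R :=
  \sum_(s : n.-tuple bool) \sum_(t : n.-tuple bool)
    uniform_pmf R s * uniform_pmf R t * (LCS s t)%:R.

(* Main.v *)
Require Import Defs.
From mathcomp Require Import all_boot all_order all_algebra.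
From mathcomp Require Import all_classical all_reals all_analysis.
From mathcomp Require Import ring lra zify.
Import Order.TTheory GRing.Theory Num.Theory.
Import numFieldNormedType.Exports.
Local Open Scope classical_set_scope.
Local Open Scope ring_scope.

(** At least one common subsequence of every length
    [m <= LCS s t] exists, so P(LCS >= m) is at most the expected number of
    common subsequences of length [m].  Matching greedily from the left, the
    number of strings of length [n] containing a given [u] of length [m] is at
    most [z^-n (z / (1 - z))^m] for every [0 < z <= 1/2].  Hence
    P(LCS >= m) <= (2 z)^(-2n) (2 (z / (1 - z))^2)^m.  For [z = 13/100] this is
    [A^n q^m] with [A^15 q^13 <= 1], so that the tail beyond [m = 13n/15] sums
    to a constant, and 13/15 < 0.867. *)

Lemma sum_tuple_cons (V : nmodType) (T : finType) (n : nat)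
    (F : seq T -> V) :
  \sum_(s : n.+1.-tuple T) F s =
  \sum_(a : T) \sum_(s : n.-tuple T) F (a :: s).
Proof.
rewrite pair_big /=.
rewrite (reindex (fun p : T * n.-tuple T => [tuple of p.1 :: p.2])) //=.
exists (fun s : n.+1.-tuple T => (thead s, [tuple of behead s])).
- by move=> [a s] _ /=; congr pair; apply: val_inj.
- by move=> s _ /=; rewrite [RHS]tuple_eta.
Qed.

(** Split on the first letter of [s]: for a nonempty [u], one value consumes the head of [u] and the
    other leaves [u] intact. The bound obeys the same recurrence with equality, since
    [1 + z / (1 - z) = z^-1 * (z / (1 - z))]. *)
Lemma supersequence_count_le (R : realFieldType) (z : R) (n : nat)
    (u : seq bool) :
  0 < z -> z <= 1 / 2 ->
  \sum_(s : n.-tuple bool) (subseq u s)%:R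
    <= z^-1 ^+ n * (z / (1 - z)) ^+ size u.
Proof.
move=> z0 z2; have z1 : 0 < 1 - z by lra.
have zV2 : 2 <= z^-1 by rewrite -[2]invrK lef_pV2 ?posrE ?invr_gt0 //; lra.
have r0 : 0 <= z / (1 - z) by rewrite divr_ge0 // ltW.
elim: n u => [|n IHn] u.
  rewrite (big_pred1 [tuple]) => [|s]; last first.
    by rewrite (tuple0 s) /= eqxx.
  case: u => [|a u] /=; first by rewrite !expr0 mulr1.
  by rewrite expr0 mul1r exprn_ge0.
rewrite (@sum_tuple_cons _ _ _ (fun s => (subseq u s)%:R)) big_bool.
(* For empty [u] the count doubles with each letter, which [2 <= z^-1] absorbs. *)
case: u => [|a u].
  have E a : \sum_(s : n.-tuple bool) (subseq [::] (a :: s))%:R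
    = \sum_(s : n.-tuple bool) (subseq [::] s)%:R :> R.
    by apply: eq_bigr => s _; rewrite !sub0seq.
  have := IHn [::]; rewrite !E !expr0 !mulr1 exprS => IH.
  have P0 : 0 <= z^-1 ^+ n by rewrite exprn_ge0 // invr_ge0 ltW.
  by apply: le_trans (ler_wpM2r P0 zV2); rewrite mulr_natl mulr2n lerD.
have step : z^-1 ^+ n * (z / (1 - z)) ^+ size u
    + z^-1 ^+ n * (z / (1 - z)) ^+ (size u).+1
    = z^-1 ^+ n.+1 * (z / (1 - z)) ^+ (size u).+1.
  by rewrite !exprS; field; lra.
rewrite -step.
have := IHn u; have := IHn (a :: u); case: a => /= H1 H2; lra.
Qed.

(** The maximum is attained, or is the default 0, realised by the empty string; prefixes of a
    witness give all shorter lengths. *)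
Lemma LCS_subseq (T : finType) (s t : seq T) (m : nat) :
  (m <= LCS s t)%N -> exists u : m.-tuple T, is_common_subseq s t u.
Proof.
move=> le_m.
have [k [lemk [u]]] : exists k, (m <= k)%N /\
    exists u : k.-tuple T, is_common_subseq s t u.
  have : LCS s t = 0%N \/ exists u : (LCS s t).-tuple T, is_common_subseq s t u.
    rewrite /LCS; apply: (big_ind (fun k : nat => k = 0%N \/
      exists u : k.-tuple T, is_common_subseq s t u)); first by left.
      by move=> x y hx hy; rewrite /maxn; case: ifP.
    by move=> i /existsP; right.
  case=> [L0|]; last by exists (LCS s t).
  exists 0%N; split; first by rewrite -L0.
  by exists [tuple]; rewrite /is_common_subseq !sub0seq.
case/andP=> us ut.
have sz : size (take m u) == m by rewrite size_takel ?size_tuple.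
by exists (Tuple sz); rewrite /is_common_subseq /=
  !(subseq_trans (take_subseq _ _)).
Qed.

(** Pointwise form of the first-moment bound: each length from [k] to [LCS s t] contributes at least
    1 to the sum. *)
Lemma LCS_le_count (R : realFieldType) (T : finType) (n k : nat)
    (s t : n.-tuple T) :
  (LCS s t)%:R <= k%:R + \sum_(k <= m < n.+1) \sum_(u : m.-tuple T)
    (subseq u s)%:R * (subseq u t)%:R :> R.
Proof.
have LCSn : (LCS s t <= n)%N.
  by apply/bigmax_leqP => i _; rewrite -ltnS -[X in (_ < X.+1)%N](size_tuple s).
have cnt0 m : 0 <= \sum_(u : m.-tuple T) (subseq u s)%:R * (subseq u t)%:R :> R.
  by apply: sumr_ge0 => u _; rewrite mulr_ge0.
have [lek|/ltnW kL] := leqP (LCS s t) k.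
  apply: le_trans (_ : k%:R <= _); first by rewrite ler_nat.
  by rewrite lerDl sumr_ge0.
rewrite (@big_cat_nat _ _ _ (LCS s t).+1) //=; last by rewrite ltnW.
rewrite addrA; apply: (@le_trans _ _ (k%:R + \sum_(k <= m < (LCS s t).+1) 1)).
  by rewrite sumr_const_nat -natrD ler_nat; lia.
rewrite -[leLHS]addr0; apply: lerD; last by apply: sumr_ge0 => m _; apply: cnt0.
rewrite lerD2l.
apply: ler_sum_nat => m; rewrite ltnS => /andP[_ /LCS_subseq[u /andP[us ut]]].
rewrite (bigD1 u) //= us ut mul1r lerDl.
by apply: sumr_ge0 => v _; rewrite mulr_ge0.
Qed.

Lemma expected_LCS_le (R : realType) (z : R) (n k : nat) :
  0 < z -> z <= 1 / 2 ->
  expected_LCS R n <= k%:R + ((2 * z) ^- 2) ^+ n *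
    \sum_(k <= m < n.+1) (2 * (z / (1 - z)) ^+ 2) ^+ m.
Proof.
move=> z0 z2.
pose p : R := (2 ^+ n)^-1.
have p0 : 0 <= p by rewrite invr_ge0 exprn_ge0.
have pE (s : n.-tuple bool) : uniform_pmf R s = p.
  by rewrite /uniform_pmf card_tuple card_bool natrX.
have p1 : \sum_(s : n.-tuple bool) p = 1.
  by rewrite sumr_const card_tuple card_bool -mulr_natl natrX divff.
have -> : expected_LCS R n =
    \sum_(s : n.-tuple bool) \sum_(t : n.-tuple bool) p * p * (LCS s t)%:R.
  by apply: eq_bigr => s _; apply: eq_bigr => t _; rewrite !pE.
apply: (@le_trans _ _ (\sum_(s : n.-tuple bool) \sum_(t : n.-tuple bool)
   (p * p * k%:R + \sum_(k <= m < n.+1) \sum_(u : m.-tuple bool)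
    (p * (subseq u s)%:R) * (p * (subseq u t)%:R)))).
  apply: ler_sum => s _; apply: ler_sum => t _.
  apply: (le_trans (ler_wpM2l (mulr_ge0 p0 p0) (@LCS_le_count R _ n k s t))).
  rewrite mulrDr lerD2l mulr_sumr; apply: ler_sum => m _.
  by rewrite mulr_sumr; apply: ler_sum => u _; rewrite mulrACA.
under eq_bigr do rewrite big_split /=.
rewrite big_split /= lerD //.
  under eq_bigr do rewrite -mulr_suml -mulr_sumr p1 mulr1.
  by rewrite -mulr_suml p1 mul1r.
(* With the sums over [m] and [u] outermost, independence factors the sums over [s] and [t] into a
   square, bounded by [c * c] for each of the [2 ^ m] strings [u]. *)
under eq_bigr do rewrite exchange_big /=.
rewrite exchange_big /= mulr_sumr; apply: ler_sum => m _.
under eq_bigr do rewrite exchange_big /=.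
rewrite exchange_big /=.
under eq_bigr do under eq_bigr do rewrite -mulr_sumr.
under eq_bigr do rewrite -mulr_suml.
pose c : R := p * (z^-1 ^+ n * (z / (1 - z)) ^+ m).
apply: (@le_trans _ _ (\sum_(u : m.-tuple bool) c * c)).
  apply: ler_sum => u _; rewrite -!mulr_sumr.
  have h : p * \sum_(s : n.-tuple bool) (subseq u s)%:R <= c.
    apply: ler_wpM2l => //.
    by rewrite -[m in leRHS](size_tuple u) supersequence_count_le.
  by apply: ler_pM => //; rewrite mulr_ge0 // sumr_ge0.
rewrite sumr_const card_tuple card_bool -[leLHS]mulr_natl natrX /c /p.
have -> : (2 * z) ^- 2 = 2^-1 * 2^-1 * (z^-1 * z^-1).
  by field; rewrite gt_eqF.
by rewrite expr2 !exprMn !exprVn le_eqVlt; apply/orP; left; apply/eqP; ring.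
Qed.

Lemma geometric_tail_le (R : realFieldType) (q : R) (k n : nat) :
  0 <= q -> q <= 1 / 2 -> \sum_(k <= m < n) q ^+ m <= 2 * q ^+ k.
Proof.
move=> q0 q2.
have [nk|/ltnW kn] := leqP n k; first by rewrite big_geq // mulr_ge0 ?exprn_ge0.
(* The extra term makes the induction close: [q ^+ j + 2 * q ^+ j.+1 <= 2 * q ^+ j] as
   [q <= 1 / 2]. *)
suff : \sum_(k <= m < n) q ^+ m + 2 * q ^+ n <= 2 * q ^+ k.
  by apply: le_trans; rewrite lerDl mulr_ge0 ?exprn_ge0.
rewrite -(subnKC kn); elim: (n - k)%N => [|d IHd].
  by rewrite addn0 big_geq // add0r.
rewrite addnS big_nat_recr ?leq_addr //= exprS.
apply: le_trans IHd; rewrite -addrA lerD2l.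
have := exprn_ge0 (k + d) q0; nra.
Qed.

Theorem theorem5p1 (R : realType) :
  exists2 e : nat -> R,
    e =o_\oo (fun n : nat => n%:R : R) &
    forall n : nat, expected_LCS R n <= 867 / 1000 * n%:R + e n.
Proof.
(* 1 comes from rounding [k] up, 2 from the geometric tail. *)
exists (fun=> 3).
  apply/eqoP => eps eps0; near=> n.
  rewrite !ger0_norm // mulrC -ler_pdivrMr //.
  by near: n; exact: nbhs_infty_ger.
move=> n; pose k := (13 * n %/ 15).+1.
have nk : (13 * n <= 15 * k)%N by rewrite /k; lia.
have kn : k%:R <= 13 / 15 * n%:R + 1 :> R.
  have : (15 * k)%:R <= (13 * n + 15)%:R :> R by rewrite ler_nat /k; lia.
  rewrite natrD !natrM; lra.
(* Close to [2 / 15], which minimises the bound at [m = 13 n / 15]. *)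
pose z : R := 13 / 100.
have z0 : 0 < z by rewrite /z; lra.
have z2 : z <= 1 / 2 by rewrite /z; lra.
apply: (le_trans (@expected_LCS_le R z n k z0 z2)).
have -> : (2 * z) ^- 2 = 2500 / 169 :> R by rewrite /z; field.
have -> : 2 * (z / (1 - z)) ^+ 2 = 338 / 7569 :> R by rewrite /z; field.
set A : R := 2500 / 169; set q : R := 338 / 7569.
have A0 : 0 <= A by rewrite /A; lra.
have q0 : 0 <= q by rewrite /q; lra.
have q2 : q <= 1 / 2 by rewrite /q; lra.
have Aq : A ^+ 15 * q ^+ 13 <= 1 by rewrite /A /q; lra.
have An : A ^+ n * q ^+ k <= 1.
  (* The 15th power clears the fraction [13 / 15], reducing the claim to
     [(A ^+ 15 * q ^+ 13) ^+ n <= 1]. *)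
  rewrite -(@expr_le1 _ 15) ?mulr_ge0 ?exprn_ge0 // exprMn -!exprM.
  rewrite [(k * 15)%N]mulnC.
  have qk : q ^+ (15 * k) <= q ^+ (13 * n).
    by rewrite ler_wiXn2l //; lra.
  apply: (le_trans (ler_wpM2l (exprn_ge0 _ A0) qk)).
  by rewrite [(n * 15)%N]mulnC !exprM -exprMn exprn_ile1 // mulr_ge0 ?exprn_ge0.
have tail := ler_wpM2l (exprn_ge0 n A0) (@geometric_tail_le R q k n.+1 q0 q2).
have n0 : 0 <= n%:R :> R by [].
by apply: (le_trans (lerD kn tail)); lra.
Unshelve. all: by end_near.
Qed.
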